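(* Let $D$ be a finite simple digraph that consists of $k$ components where $k\ge 1$, and let $D_i$ denote the $i$-th component of $D$, $1\le i\le k$. Then $$F(D)=\max_{1\le j\le k}\left(F(D_j)+\sum_{i=1,\,i\ne j}^{k}|V(D_i)|\right).$$
   Context: A finite simple digraph $D=(V,A)$ has finite nonempty vertex set $V$ and arc set $A$ consisting of ordered pairs of distinct vertices (no loops, no parallel arcs; both $(u,v)$ and $(v,u)$ may be present). $N_D^+(v)=\{u:(v,u)\in A\}$. The components of $D$ are its weakly connected components, i.e. the subdigraphs induced by the vertex sets of the connected components of the underlying undirected graph. Zero forcing: for $S\subseteq V$ let $B^0(S)=S$ and $B^{i+1}(S)=B^i(S)\cup\{w:\{w\}=N_D^+(v)\setminus B^i(S)\text{ for some }v\in B^i(S)\}$. $S$ is a zero forcing set (ZFS) if $B^t(S)=V$ for some $t\ge 0$, and a failed zero forcing set (FZFS) otherwise. The failed zero forcing number $F(D)$ is the largest cardinality of an FZFS of $D$. *)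

(* Defs.v *)
From mathcomp Require Import all_boot.

Set Implicit Arguments.
Unset Strict Implicit.
Unset Printing Implicit Defensive.

Record digraph := Digraph {
  vertex :> finType;
  arc : rel vertex;
  arc_irr : irreflexive arc;
  vertex_gt0 : 0 < #|vertex|
}.

Section ZeroForcing.

Variable D : digraph.
Implicit Types (S : {set D}) (u v w : D).

Definition outN v : {set D} := [set u | arc v u].

Definition force S : {set D} :=
  S :|: [set w | [exists v in S, outN v :\: S == [set w]]].

Definition blue (i : nat) S : {set D} := iter i force S.

Definition zero_forcing S : Prop := exists t : nat, blue t S = [set: D].

(* Forcing stabilises after at most #|D| rounds, which makes [zero_forcing]
   decidable. *)
Definition zero_forcingb S : bool :=
  [exists t : 'I_(#|D|).+1, blue t S == [set: D]].

Lemma zero_forcingP S : reflect (zero_forcing S) (zero_forcingb S).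
Proof.
apply: (iffP existsP) => [[t /eqP bt]|[t bt]]; first by exists t.
have blueS i : blue i.+1 S = force (blue i S) by [].
have stab_or n : force (blue n S) = blue n S \/ n <= #|blue n S|.
  elim: n => [|n IHn]; first by right.
  have [fixn|/eqP nfix] := eqVneq (force (blue n S)) (blue n S).
    by left; rewrite blueS !fixn.
  case: IHn => [/nfix //|le_n]; right; rewrite blueS.
  apply: leq_ltn_trans le_n (proper_card _).
  by rewrite properEneq subsetUl andbT eq_sym; apply/eqP.
have full_fix : force [set: D] = [set: D].
  by apply/eqP; rewrite eqEsubset subsetT subsetUl.
have stab_iter n m : force (blue n S) = blue n S -> blue (m + n) S = blue n S.
  by move=> fixn; elim: m => // m IHm; rewrite addSn blueS IHm.
have fixD : force (blue #|D| S) = blue #|D| S.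
  have [//|leD] := stab_or #|D|.
  suff -> : blue #|D| S = [set: D] by [].
  by apply/eqP; rewrite eqEcard subsetT cardsT.
exists ord_max; apply/eqP; rewrite /=.
rewrite -(stab_iter _ t fixD) addnC.
by apply: etrans (stab_iter t #|D| _) _; rewrite ?bt.
Qed.

Definition failed_zero_forcing S : Prop := ~ zero_forcing S.

Definition failed_zf_number : nat :=
  \max_(S : {set D} | ~~ zero_forcingb S) #|S|.

(* The maximum is over a nonempty family, as [set0] never forces anything. *)
Lemma failed_zf_numberP :
  (exists S, failed_zero_forcing S /\ #|S| = failed_zf_number) /\
  (forall S, failed_zero_forcing S -> #|S| <= failed_zf_number).
Proof.
split=> [|S FS]; last first.
  have NS : ~~ zero_forcingb S by apply/zero_forcingP.
  exact: (@leq_bigmax_cond _ _ (fun A : {set D} => #|A|) _ NS).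
have N0 : ~~ zero_forcingb set0.
  apply/zero_forcingP => -[t].
  have -> : blue t set0 = set0.
    elim: t => //= t; rewrite /blue /= => ->; apply/setP=> w.
    by rewrite !inE; apply/existsP=> -[v]; rewrite inE.
  move/(congr1 (fun A : {set D} => #|A|)); rewrite cards0 cardsT => D0.
  by have := vertex_gt0 D; rewrite -D0.
have gt0 : 0 < #|[pred S : {set D} | ~~ zero_forcingb S]|.
  by apply/card_gt0P; exists set0.
have [S NS eS] := eq_bigmax_cond (fun S : {set D} => #|S|) gt0.
exists S; split; last by rewrite -eS; apply: eq_bigl => A; rewrite inE.
by move/zero_forcingP; apply/negP.
Qed.

Definition adj u v : bool := arc u v || arc v u.

Definition components : {set {set D}} :=
  equivalence_partition (connect adj) [set: D].

Definition component := {C : {set D} | C \in components}.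

Section Induced.

Variables (C : {set D}) (C_neq0 : C != set0).

Definition induced_arc : rel {x : D | x \in C} := fun x y => arc (val x) (val y).

Lemma induced_arc_irr : irreflexive induced_arc.
Proof. by move=> x; apply: arc_irr. Qed.

Lemma induced_gt0 : 0 < #|{: {x : D | x \in C}}|.
Proof. by rewrite card_sig card_gt0. Qed.

Definition induced : digraph := Digraph induced_arc_irr induced_gt0.

End Induced.

Lemma component_neq0 (C : component) : val C != set0.
Proof.
case: C => C /= /imsetP[u _ ->]; apply/set0Pn; exists u.
by rewrite !inE connect0.
Qed.

Definition component_digraph (C : component) : digraph :=
  induced (component_neq0 C).

End ZeroForcing.

(* Main.v *)
Require Import Defs.
From mathcomp Require Import all_boot.

(** No arc leaves or enters a component, so forcing commutes with restriction
    to a component. Hence a set is zero forcing iff its trace on each component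
    is. A failed set of [D] therefore has a failed trace on some component, and
    conversely a failed set of one component stays failed after adding all the
    vertices of the others. *)

Set Implicit Arguments.
Unset Strict Implicit.
Unset Printing Implicit Defensive.

Section Restriction.

Variables (D : digraph) (C : {set D}) (C_neq0 : C != set0).

Definition restr (S : {set D}) : {set induced C_neq0} := [set x | val x \in S].

Lemma val_restr S : [set val x | x in restr S] = S :&: C.
Proof.
apply/setP=> y; rewrite inE; apply/imsetP/andP=> [[x xS ->]|[yS yC]].
  by split; [rewrite inE in xS | exact: (valP x)].
by exists (exist _ y yC); rewrite ?inE.
Qed.

Lemma card_restr S : #|restr S| = #|S :&: C|.
Proof. by rewrite -val_restr (card_imset _ val_inj). Qed.

Hypothesis C_closed : forall u v : D, Defs.arc u v -> (u \in C) = (v \in C).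

(** Closedness is used both ways: out-neighbours of a vertex of [C] lie in [C], so that vertex sees
    the same white out-neighbours in [D] and in the subdigraph; and a vertex forcing one of [C] must
    itself lie in [C]. *)
Lemma restr_force S : restr (force S) = force (restr S).
Proof.
(* Pushing the white out-neighbourhood forward along [val] lets equality with a singleton be
   transferred by injectivity of [val]. *)
have outN_restr (v : induced C_neq0) :
    [set val y | y in outN v :\: restr S] = outN (val v) :\: S.
  apply/setP=> y; rewrite !inE; apply/imsetP/andP=> [[z zP ->]|[yS vy]].
    by move: zP; rewrite !inE => /andP[].
  have yC : y \in C by rewrite -(C_closed vy); exact: (valP v).
  by exists (exist _ y yC); rewrite // !inE yS.
apply/setP=> x; rewrite !inE; congr (_ || _).
apply/existsP/existsP=> -[v /andP[vS /eqP eqv]].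
  (* The forced vertex is an out-neighbour of its forcer, which puts the forcer in [C]. *)
  have vx : Defs.arc v (val x).
    by have := set11 (val x); rewrite -eqv !inE => /andP[].
  have vC : v \in C by rewrite (C_closed vx); exact: (valP x).
  exists (exist _ v vC); rewrite inE vS /=; apply/eqP.
  by apply: (imset_inj val_inj); rewrite outN_restr imset_set1.
exists (val v); rewrite inE in vS; rewrite vS -outN_restr eqv imset_set1.
exact: eqxx.
Qed.

Lemma restr_blue t S : restr (blue t S) = blue t (restr S).
Proof. by elim: t => //= t IHt; rewrite restr_force IHt. Qed.

End Restriction.

Lemma blue_leq (D : digraph) (S : {set D}) m n :
  m <= n -> blue m S \subset blue n S.
Proof.
move/subnK <-; elim: (n - m) => //= d IHd.
exact: subset_trans IHd (subsetUl _ _).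
Qed.

(** Gives a number of rounds independent of [S]: the boolean characterisation yields a time at most
    [#|D|], and blue sets only grow. *)
Lemma zero_forcing_blue (D : digraph) (S : {set D}) n :
  #|D| <= n -> zero_forcing S -> blue n S = [set: D].
Proof.
move=> le_n /zero_forcingP/existsP[t /eqP bt].
apply/eqP; rewrite -subTset -bt; apply: blue_leq.
by apply: leq_trans le_n; rewrite -ltnS.
Qed.

Lemma failed_zf_card_leq (D : digraph) (S : {set D}) :
  ~ zero_forcing S -> #|S| <= failed_zf_number D.
Proof. by case: (failed_zf_numberP D) => _; apply. Qed.

Section Components.

Variable D : digraph.
Implicit Types (C : component D) (S : {set D}) (x y : D).

Lemma connect_adj_sym : connect_sym (@adj D).
Proof. by apply: sym_connect_sym => x y; rewrite /adj orbC. Qed.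

(** A component is an equivalence class of [connect], so any of its members can serve as
    representative. *)
Lemma mem_component C x y : x \in val C -> (y \in val C) = connect (@adj D) x y.
Proof.
case: C => C /= /imsetP[z _ ->]; rewrite !inE => zx.
by rewrite (same_connect connect_adj_sym zx).
Qed.

Lemma component_eq C C' x : x \in val C -> x \in val C' -> C = C'.
Proof.
by move=> xC xC'; apply/val_inj/setP=> y; rewrite (mem_component _ xC) (mem_component _ xC').
Qed.

Lemma component_ex x : exists C, x \in val C.
Proof.
have xP : [set y in [set: D] | connect (@adj D) x y] \in components D.
  exact: imset_f.
by exists (exist (fun A => A \in components D) _ xP); rewrite !inE connect0.
Qed.

Lemma component_closed C x y : Defs.arc x y -> (x \in val C) = (y \in val C).
Proof.
move=> xy; have cxy : connect (@adj D) x y by apply: connect1; rewrite /adj xy.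
apply/idP/idP=> H; rewrite (mem_component _ H) //.
by rewrite connect_adj_sym.
Qed.

Definition trace C S : {set component_digraph C} := restr (component_neq0 C) S.

Lemma card_trace C S : #|trace C S| = #|S :&: val C|.
Proof. exact: card_restr. Qed.

Lemma trace_blue C t S : trace C (blue t S) = blue t (trace C S).
Proof. by apply: restr_blue; apply: component_closed. Qed.

Lemma card_component C : #|component_digraph C| = #|val C|.
Proof. by rewrite card_sig. Qed.

Lemma zero_forcing_trace S :
  zero_forcing S <-> forall C, zero_forcing (trace C S).
Proof.
split=> [[t bt] C|zfS].
  by exists t; rewrite -trace_blue bt; apply/setP=> x; rewrite !inE.
(* The components may finish at different times; [#|D|] bounds the order of each, so this many
   rounds suffice for all of them at once. *)
exists #|D|; apply/setP=> x; rewrite inE.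
have [C xC] := component_ex x.
have leC : #|component_digraph C| <= #|D| by rewrite card_component max_card.
have /setP/(_ (exist _ x xC)) := zero_forcing_blue leC (zfS C).
by rewrite -trace_blue !inE.
Qed.

Variables (k : nat) (C : 'I_k -> component D) (C_bij : bijective C).

(** Double counting of the pairs of a vertex of [S] and a component containing it. *)
Lemma card_sum_components S : #|S| = \sum_(i < k) #|S :&: val (C i)|.
Proof.
have [idx idxK CK] := C_bij.
under eq_bigr => i _.
  rewrite -sum1_card (eq_bigl _ _ (fun x => in_setI x S _)) big_mkcondr; over.
rewrite exchange_big /= -sum1_card; apply: eq_bigr => x _.
(* For fixed [x], only the index of the component of [x] contributes to the inner sum. *)
have [C0 xC0] := component_ex x.
rewrite (bigD1 (idx C0)) //= CK xC0 big1 // => i /eqP ne_i.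
by case: ifP => // xCi; case: ne_i; rewrite (component_eq xC0 xCi) idxK.
Qed.

End Components.

Theorem theorem4p1 (D : digraph) (k : nat) (k_ge1 : 1 <= k)
    (C : 'I_k -> component D) (C_bij : bijective C) :
  failed_zf_number D =
  \max_(j < k) (failed_zf_number (component_digraph (C j))
                + \sum_(i < k | i != j) #|vertex (component_digraph (C i))|).
Proof.
apply/eqP; rewrite eqn_leq; apply/andP; split.
  have [[S [failS <-]] _] := failed_zf_numberP D.
  have /existsP[j failj] : [exists j, ~~ zero_forcingb (trace (C j) S)].
    apply: contra_notT failS; rewrite negb_exists => /forallP zfS.
    apply/zero_forcing_trace => C0; have [idx _ CK] := C_bij.
    by have := zfS (idx C0); rewrite CK negbK => /zero_forcingP.
  (* The trace on [C j] is failed, hence bounded by the failed number there; on every other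
     component the trivial bound by its order is enough. *)
  apply: leq_trans (leq_bigmax j).
  rewrite (card_sum_components C_bij) (bigD1 j) //=; apply: leq_add.
    by rewrite -card_trace; apply/failed_zf_card_leq/(elimN (zero_forcingP _)).
  by apply: leq_sum => i _; rewrite card_component subset_leq_card ?subsetIr.
apply/bigmax_leqP=> j _.
have [[T [failT <-]] _] := failed_zf_numberP (component_digraph (C j)).
(* A largest failed set of the [j]-th component, enlarged by every vertex outside it. *)
pose S : {set D} := [set val x | x in T] :|: ~: val (C j).
have traceS : trace (C j) S = T.
  apply/setP=> x; rewrite !inE (mem_imset _ _ val_inj).
  by rewrite (valP x) orbF.
have failS : ~ zero_forcing S.
  by move/zero_forcing_trace/(_ (C j)); rewrite traceS.
apply: leq_trans (failed_zf_card_leq failS).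
rewrite (card_sum_components C_bij S) [leqRHS](bigD1 j) //=; apply: leq_add.
  by rewrite -card_trace traceS.
(* For [i != j] the component [C i] is disjoint from [C j], so [S] contains all of it. *)
apply: leq_sum => i ne_ij; rewrite card_component; apply: subset_leq_card.
apply/subsetP=> x xCi; rewrite !inE xCi andbT; apply/orP; right.
apply/negP=> xCj; case/eqP: ne_ij.
by apply: (bij_inj C_bij); apply: component_eq xCi xCj.
Qed.
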